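(* Let $g$ be a real-valued function that is defined and smooth on some neighborhood of $\mathbb{O}^{n\times k}$. For any $\alpha>0$, let $P_{\alpha}$ be a maximizer of $$\max_{P\in\mathbb{O}^{n\times k}}\Big\{g(P)-\alpha\|P\|_{2,1}\Big\}.$$ Consider $\{P_{\alpha}:\alpha>0\}$ and let $P_*$ be an accumulation point of $\{P_{\alpha}:\alpha>0\}$ as $\alpha\to\infty$. Then $P_*\in\mathbb{O}^{n\times k}$ and $\|P_*\|_{2,1}=k$, and thus $P_*$ can be permuted, through permuting its rows, to a matrix of the form $$\begin{bmatrix}\widehat P\\ 0_{(n-k)\times k}\end{bmatrix}\quad\text{with } \widehat P\in\mathbb{O}^{k\times k}.$$
   Context: $n,k$ are integers with $1\le k\le n$. $\mathbb{O}^{n\times k}:=\{P\in\mathbb{R}^{n\times k}: P^{\mathrm T}P=I_k\}$ is the Stiefel manifold (in particular $\mathbb{O}^{k\times k}$ is the set of $k\times k$ real orthogonal matrices). A neighborhood of $\mathbb{O}^{n\times k}$ means a set $\{P\in\mathbb{R}^{n\times k}:\|P^{\mathrm T}P-I_k\|<\delta\}$ for some constant $\delta>0$ and some matrix norm $\|\cdot\|$. The $(2,1)$-norm of $P\in\mathbb{R}^{n\times k}$ is $\|P\|_{2,1}=\sum_{i=1}^n\|P_{(i,:)}\|_2$, where $P_{(i,:)}$ is the $i$th row of $P$ and $\|\cdot\|_2$ is the Euclidean norm. For each $\alpha>0$, $P_\alpha$ may be any one of the (global) maximizers. $P_*$ is an accumulation point of $\{P_\alpha:\alpha>0\}$ as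 $\alpha\to\infty$ if there is an increasing sequence $\alpha_j\to\infty$ with $P_{\alpha_j}\to P_*$. When $k=n$ the zero block is empty. *)

(* Defs.v *)
From HB Require Import structures.
From mathcomp Require Import all_boot all_order all_algebra all_fingroup.
From mathcomp Require Import all_classical all_reals all_analysis.

Set Implicit Arguments.
Unset Strict Implicit.
Unset Printing Implicit Defensive.

Import Order.TTheory GRing.Theory Num.Theory.
Import numFieldNormedType.Exports.

Local Open Scope classical_set_scope.
Local Open Scope ring_scope.

Definition stiefel (R : realType) (n k : nat) : set 'M[R]_(n, k) :=
  [set P | P^T *m P = 1%:M].

Definition norm2 (R : realType) (k : nat) (v : 'rV[R]_k) : R :=
  Num.sqrt (\sum_(j < k) v ord0 j ^+ 2).

Definition norm21 (R : realType) (n k : nat) (P : 'M[R]_(n, k)) : R :=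
  \sum_(i < n) norm2 (row i P).

(* Submultiplicativity is not required: any norm on the space of matrices. *)
Record is_matrix_norm (R : realType) (m n : nat) (N : 'M[R]_(m, n) -> R) : Prop :=
  IsMatrixNorm {
    matrix_norm_ge0 : forall A, 0 <= N A;
    matrix_norm_eq0 : forall A, N A = 0 -> A = 0;
    matrix_normZ : forall (c : R) A, N (c *: A) = `|c| * N A;
    matrix_norm_triangle : forall A B, N (A + B) <= N A + N B
  }.

Definition stiefel_nbhd (R : realType) (n k : nat) (N : 'M[R]_k -> R)
    (delta : R) : set 'M[R]_(n, k) :=
  [set P | N (P^T *m P - 1%:M) < delta].

(* [Cr_on r U f], for an open set U: every iterated partial derivative of f of
   order r (with respect to the matrix entries) exists and is continuous on U.
   The values of f outside U play no role, because U is open. *)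
Fixpoint Cr_on (R : realType) (n k : nat) (r : nat) (U : set 'M[R]_(n, k))
    (f : 'M[R]_(n, k) -> R) : Prop :=
  match r with
  | 0%N => forall P, U P -> {for P, continuous f}
  | r'.+1 => forall (i : 'I_n) (j : 'I_k),
      (forall P, U P -> derivable f P (delta_mx i j)) /\
      Cr_on r' U ('D_(delta_mx i j) f)
  end.

Definition smooth_on (R : realType) (n k : nat) (U : set 'M[R]_(n, k))
    (f : 'M[R]_(n, k) -> R) : Prop :=
  forall r : nat, Cr_on r U f.

Definition is_maximizer (R : realType) (T : Type) (S : set T) (f : T -> R)
    (x : T) : Prop :=
  S x /\ forall y, S y -> f y <= f x.

Definition accumulation_at_infty (R : realType) (n k : nat)
    (P : R -> 'M[R]_(n, k)) (Pstar : 'M[R]_(n, k)) : Prop :=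
  exists a : nat -> R,
    [/\ increasing_seq a,
        forall j, 0 < a j,
        a j @[j --> \oo] --> +oo &
        P (a j) @[j --> \oo] --> Pstar].

(* The cast along k + (n - k) = n is needed because the block matrix has
   k + (n - k) rows. *)
Definition pad_rows (R : realType) (n k : nat) (hkn : (k <= n)%N)
    (Q : 'M[R]_k) : 'M[R]_(n, k) :=
  castmx (subnKC hkn, erefl k) (col_mx Q (0 : 'M[R]_(n - k, k))).

(* Main.v *)
Require Import Defs.
From HB Require Import structures.
From mathcomp Require Import all_boot all_order all_algebra all_fingroup.
From mathcomp Require Import all_classical all_reals all_analysis.
From mathcomp Require Import lra.
Import Order.TTheory GRing.Theory Num.Theory.
Import numFieldNormedType.Exports.
Local Open Scope classical_set_scope.
Local Open Scope ring_scope.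

(** On the Stiefel manifold the (2,1)-norm is at least [k], and it equals [k]
    exactly at the matrices with [k] unit rows and all other rows zero.  Indeed,
    [Q *m Q^T] is an orthogonal projection, so its diagonal entries, the squared
    row norms of [Q], lie in [0, 1] ([stiefel_norm2_row_le1]); they add up to its
    trace [k].  Hence the sum of the row norms dominates the sum [k] of their
    squares ([stiefel_norm21_ge]), with equality only if each row norm is 0 or 1
    ([stiefel_norm21_eq_row01]).  Sorting the rows so that the nonzero ones come
    first then gives the block form ([stiefel_norm21_eq_pad_rows]).

    The theorem is a penalty argument on top of this.  Compare the maximizer
    [P alpha] with the matrix [P0] made of the identity above a zero block,
    whose (2,1)-norm is the minimum [k]: maximality gives
      [norm21 (P alpha) <= k + (g (P alpha) - g P0) / alpha].
    Along a sequence of parameters tending to infinity for which the maximizers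
    converge to [Pstar], the limit is again in the Stiefel manifold, a closed
    set ([stiefel_cvg]), so [g] is continuous there.  The difference of values
    of [g] thus converges, the last term tends to 0, and continuity of the
    (2,1)-norm ([norm21_continuous]) yields [norm21 Pstar <= k]. *)

Lemma norm2_ge0 {R : realType} {k : nat} (v : 'rV[R]_k) : 0 <= norm2 v.
Proof. exact: sqrtr_ge0. Qed.

Lemma sqr_norm2 {R : realType} {k : nat} (v : 'rV[R]_k) :
  norm2 v ^+ 2 = \sum_(j < k) v ord0 j ^+ 2.
Proof. by rewrite sqr_sqrtr ?sumr_ge0 // => j _; apply: sqr_ge0. Qed.

Lemma norm2_eq0 {R : realType} {k : nat} (v : 'rV[R]_k) :
  (norm2 v == 0) = (v == 0).
Proof.
apply/eqP/eqP => [v0|->].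
  have sum0 : \sum_(j < k) v ord0 j ^+ 2 = 0 by rewrite -sqr_norm2 v0 expr0n.
  apply/rowP => j; apply/eqP; rewrite mxE -sqrf_eq0; apply/eqP.
  by apply: (psumr_eq0P _ sum0) => // i _; apply: sqr_ge0.
by rewrite /norm2 big1 ?sqrtr0 // => j _; rewrite mxE expr0n.
Qed.

Lemma sqr_norm2_row {R : realType} {n k : nat} (Q : 'M[R]_(n, k)) (i : 'I_n) :
  norm2 (row i Q) ^+ 2 = (Q *m Q^T) i i.
Proof.
by rewrite sqr_norm2 mxE; apply: eq_bigr => j _; rewrite !mxE expr2.
Qed.

Lemma stiefel_sum_sqr_norm2 {R : realType} {n k : nat} {Q : 'M[R]_(n, k)} :
  stiefel Q -> \sum_(i < n) norm2 (row i Q) ^+ 2 = k%:R.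
Proof.
move=> QTQ; under eq_bigr do rewrite sqr_norm2_row.
by rewrite -/(\tr (Q *m Q^T)) mxtrace_mulC QTQ mxtrace1.
Qed.

(** The symmetric idempotent [M = Q *m Q^T] satisfies
    [M i i = \sum_j M i j ^+ 2 >= M i i ^+ 2], which forces [M i i <= 1];
    and [M i i] is the squared norm of row [i]. *)
Lemma stiefel_norm2_row_le1 {R : realType} {n k : nat} {Q : 'M[R]_(n, k)}
    (i : 'I_n) :
  stiefel Q -> norm2 (row i Q) <= 1.
Proof.
move=> QTQ; set M := Q *m Q^T.
have MM : M *m M = M by rewrite /M mulmxA -(mulmxA Q) QTQ mulmx1.
have MT : M^T = M by rewrite /M trmx_mul trmxK.
have Mii : M i i = \sum_(j < n) M i j ^+ 2.
  rewrite -{1}MM mxE; apply: eq_bigr => j _.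
  by rewrite expr2 -{2}MT [_^T _ _]mxE.
have Msq : M i i ^+ 2 <= M i i.
  rewrite {2}Mii (bigD1 i) //= lerDl sumr_ge0 // => j _.
  exact: sqr_ge0.
rewrite -(ler_pXn2r (n := 2)) ?nnegrE ?norm2_ge0 ?ler01 //.
rewrite sqr_norm2_row -/M expr1n leNgt; apply/negP => M1.
have M0 : 0 < M i i by apply: lt_trans M1.
by move: Msq; rewrite expr2 ger_pMl // leNgt M1.
Qed.

Lemma stiefel_sqr_norm2_le {R : realType} {n k : nat} {Q : 'M[R]_(n, k)}
    (i : 'I_n) :
  stiefel Q -> norm2 (row i Q) ^+ 2 <= norm2 (row i Q).
Proof.
move=> hQ; rewrite expr2 ler_piMl ?norm2_ge0 //.
exact: stiefel_norm2_row_le1.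
Qed.

(** Numbers in [0, 1] dominate their squares, and the squared row norms add up
    to [k]. *)
Lemma stiefel_norm21_ge {R : realType} {n k : nat} {Q : 'M[R]_(n, k)} :
  stiefel Q -> k%:R <= norm21 Q.
Proof.
move=> hQ; rewrite -(stiefel_sum_sqr_norm2 hQ).
by apply: ler_sum => i _; apply: stiefel_sqr_norm2_le.
Qed.

(** The case of equality in [stiefel_norm21_ge]: the gaps between the row norms
    and their squares are nonnegative with sum 0, so each of them vanishes. *)
Lemma stiefel_norm21_eq_row01 {R : realType} {n k : nat} {Q : 'M[R]_(n, k)} :
  stiefel Q -> norm21 Q = k%:R ->
  forall i, norm2 (row i Q) = (row i Q != 0)%:R.
Proof.
move=> hQ hk i.
have gap0 : \sum_(j < n) (norm2 (row j Q) - norm2 (row j Q) ^+ 2) = 0.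
  by rewrite sumrB (stiefel_sum_sqr_norm2 hQ) -/(norm21 Q) hk subrr.
have /eqP : norm2 (row i Q) - norm2 (row i Q) ^+ 2 = 0.
  apply: (psumr_eq0P _ gap0) => // j _.
  by rewrite subr_ge0; apply: stiefel_sqr_norm2_le.
rewrite expr2 -{1}[norm2 _]mulr1 -mulrBr mulf_eq0 norm2_eq0.
case: (eqVneq (row i Q) 0) => [r0 _|_ /=].
  by apply/eqP; rewrite norm2_eq0 r0.
by rewrite subr_eq0 => /eqP.
Qed.

(** The permutation lists the elements of [A], then those of its complement. *)
Lemma exists_perm_sorting {n : nat} (A : {set 'I_n}) :
  exists s : 'S_n, forall i : 'I_n, (s i \in A) = (i < #|A|)%N.
Proof.
pose e := enum A ++ enum (~: A)%SET.
have size_e : size e = n by rewrite size_cat -!cardE cardsC card_ord.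
have uniq_e : uniq e.
  rewrite cat_uniq !enum_uniq /= andbT; apply/hasPn => i.
  by rewrite /= !mem_enum finset.in_setC.
have f_inj : injective (fun i : 'I_n => nth i e i).
  (* The two values of [nth] come with different defaults, [i] and [j]; they
     are made equal before uniqueness of [e] applies. *)
  move=> i j /=; rewrite (set_nth_default i j) ?size_e // => /eqP.
  by rewrite nth_uniq ?size_e // => /eqP /val_inj.
exists (perm f_inj) => i; rewrite permE nth_cat -cardE.
case: ltnP => hi; first by rewrite -mem_enum mem_nth -?cardE.
apply/negbTE; rewrite -finset.in_setC -mem_enum mem_nth //.
by rewrite -cardE -(ltn_add2l #|A|) cardsC card_ord subnKC.
Qed.

(** Recognizes a padded matrix by its vanishing lower rows, so that the cast in
    [pad_rows] need not be unfolded in later proofs. *)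
Lemma pad_rowsP {R : realType} {n k : nat} (hkn : (k <= n)%N)
    (A : 'M[R]_(n, k)) :
  (forall i : 'I_n, (k <= i)%N -> row i A = 0) ->
  A = pad_rows hkn (rowsub (widen_ord hkn) A).
Proof.
move=> A0; apply/matrixP => i j; rewrite castmxE /= cast_ord_id mxE.
case: splitP => i' /= ii'.
  by rewrite mxE; congr (A _ _); apply: val_inj.
have /rowP/(_ j) : row i A = 0 by apply: A0; rewrite ii' leq_addr.
by rewrite !mxE.
Qed.

Lemma stiefel_pad_rows {R : realType} {n k : nat} (hkn : (k <= n)%N)
    (Q : 'M[R]_k) :
  stiefel (pad_rows hkn Q) <-> stiefel Q.
Proof.
rewrite /stiefel /pad_rows /=; move: (n - k)%N (subnKC hkn) => m e; case: _ / e.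
by rewrite castmx_id tr_col_mx mul_row_col trmx0 mul0mx addr0.
Qed.

(** With [stiefel_pad_rows], this shows that the lower bound of
    [stiefel_norm21_ge] is attained; this point is the competitor against which
    the penalized maximizers are compared. *)
Lemma norm21_pad_rows1 {R : realType} {n k : nat} (hkn : (k <= n)%N) :
  norm21 (pad_rows hkn 1%:M : 'M[R]_(n, k)) = k%:R.
Proof.
rewrite /norm21 /pad_rows; move: (n - k)%N (subnKC hkn) => m e.
case: _ / e; rewrite castmx_id.
rewrite big_split_ord /= [X in _ + X]big1 => [|i _]; last first.
  by rewrite rowKd; apply/eqP; rewrite norm2_eq0 row0.
rewrite addr0 (eq_bigr (fun=> 1)) ?sumr_const ?card_ord // => i _.
rewrite rowKu rowE mulmx1 /norm2 (bigD1 i) //= big1 => [|j ji].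
  by rewrite mxE !eqxx expr1n addr0 sqrtr1.
by rewrite mxE (negbTE ji) andbF expr0n.
Qed.

Lemma stiefel_row_perm {R : realType} {n k : nat} (s : 'S_n)
    {Q : 'M[R]_(n, k)} :
  stiefel Q -> stiefel (row_perm s Q).
Proof.
rewrite /stiefel /= row_permE trmx_mul mulmxA -(mulmxA Q^T) tr_perm_mx.
by rewrite -perm_mxM mulVg perm_mx1 mulmx1.
Qed.

(** As the row norms are 0 or 1 and add up to [k], there are exactly [k] nonzero
    rows; moving them to the top leaves a zero block of [n - k] rows.  The top
    block is orthogonal because neither permuting rows nor padding with zeros
    affects the Gram matrix [Q^T *m Q]. *)
Lemma stiefel_norm21_eq_pad_rows {R : realType} {n k : nat} (hkn : (k <= n)%N)
    {Q : 'M[R]_(n, k)} :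
  stiefel Q -> norm21 Q = k%:R ->
  exists (s : 'S_n) (Qhat : 'M[R]_k),
    stiefel Qhat /\ row_perm s Q = pad_rows hkn Qhat.
Proof.
move=> hQ hk; pose A := [set i | row i Q != 0]%SET.
have cardA : #|A| = k.
  apply/eqP; rewrite -(eqr_nat R) -hk /norm21.
  under eq_bigr do rewrite stiefel_norm21_eq_row01 //.
  rewrite -natr_sum -big_mkcond /= sum1_card; apply/eqP; congr (_%:R).
  by apply: eq_card => i; rewrite inE.
have [s hs] := exists_perm_sorting A.
have sQ : row_perm s Q = pad_rows hkn (rowsub (widen_ord hkn) (row_perm s Q)).
  apply: pad_rowsP => i ki.
  have : s i \notin A by rewrite hs cardA -leqNgt.
  by rewrite inE negbK => /eqP si0; apply/rowP => j; rewrite -si0 !mxE.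
exists s, (rowsub (widen_ord hkn) (row_perm s Q)); split => //.
by apply/(stiefel_pad_rows hkn); rewrite -sQ; apply: stiefel_row_perm.
Qed.

Lemma sum_continuous_fun {R : realType} {T : topologicalType} {I : finType}
    (F : I -> T -> R) :
  (forall i, continuous (F i)) -> continuous (fun x => \sum_i F i x).
Proof. by move=> cF; apply: continuous_big => //; exact: add_continuous. Qed.

Lemma norm21_continuous {R : realType} {n k : nat} :
  continuous (@norm21 R n k).
Proof.
apply: sum_continuous_fun => i; rewrite /norm2 => Q.
apply: (@continuous_comp _ _ _ _ Num.sqrt); last exact: sqrt_continuous.
apply: sum_continuous_fun => j {}Q.
under eq_fun do rewrite mxE expr2.
by apply: continuousM; exact: coord_continuous.
Qed.

(** The entries of the Gram matrix are polynomial in those of the matrix, hence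
    continuous, and along the sequence they are constant. *)
Lemma stiefel_cvg {R : realType} {n k : nat} {u : nat -> 'M[R]_(n, k)}
    {Q : 'M[R]_(n, k)} :
  (forall j, stiefel (u j)) -> u j @[j --> \oo] --> Q -> stiefel Q.
Proof.
move=> hu uQ; apply/matrixP => i j.
have gram_cont : continuous (fun P : 'M[R]_(n, k) => (P^T *m P) i j).
  under eq_fun do rewrite mxE.
  apply: sum_continuous_fun => l P; under eq_fun do rewrite mxE.
  by apply: continuousM; exact: coord_continuous.
have := cvg_comp _ _ uQ (gram_cont Q).
under eq_cvg do rewrite /= hu.
move=> gram_cvg; exact: (cvg_unique _ gram_cvg (cvg_cst _)).
Qed.

Theorem theorem5p3 (R : realType) (n k : nat) (hk : (1 <= k)%N) (hkn : (k <= n)%N)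
    (N : 'M[R]_k -> R) (hN : is_matrix_norm N) (delta : R) (hdelta : 0 < delta)
    (g : 'M[R]_(n, k) -> R) (hg : smooth_on (stiefel_nbhd N delta) g)
    (P : R -> 'M[R]_(n, k))
    (hP : forall alpha : R, 0 < alpha ->
      is_maximizer (@stiefel R n k) (fun Q => g Q - alpha * norm21 Q) (P alpha))
    (Pstar : 'M[R]_(n, k)) (hPstar : accumulation_at_infty P Pstar) :
  [/\ stiefel Pstar,
      norm21 Pstar = k%:R &
      exists (s : 'S_n) (Phat : 'M[R]_k),
        stiefel Phat /\ row_perm s Pstar = pad_rows hkn Phat].
Proof.
have [a [_ a_gt0 a_oo Pa_cvg]] := hPstar.
have Pa_stiefel j : stiefel (P (a j)) by have [] := hP _ (a_gt0 j).
have hPs : stiefel Pstar := stiefel_cvg Pa_stiefel Pa_cvg.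
suff norm_le : norm21 Pstar <= k%:R.
  have norm_eq : norm21 Pstar = k%:R.
    by apply/eqP; rewrite eq_le norm_le stiefel_norm21_ge.
  by split=> //; apply: stiefel_norm21_eq_pad_rows.
pose P0 : 'M[R]_(n, k) := pad_rows hkn 1%:M.
have hP0 : stiefel P0.
  by apply/stiefel_pad_rows; rewrite /stiefel /= trmx1 mulmx1.
(* The smoothness hypothesis at order 0 is plain continuity. *)
have g_cont : {for Pstar, continuous g}.
  apply: (hg 0); rewrite /stiefel_nbhd /= hPs subrr.
  by rewrite -(scale0r (0 : 'M[R]_k)) (matrix_normZ hN) normr0 mul0r.
(* Maximality of [P (a j)] against the competitor [P0], divided by [a j]. *)
have penalty_le j :
    norm21 (P (a j)) <= k%:R + (a j)^-1 * (g (P (a j)) - g P0).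
  have [_ /(_ _ hP0)] := hP _ (a_gt0 j); rewrite norm21_pad_rows1 => hmax.
  rewrite -(ler_pM2l (a_gt0 j)) mulrDr mulVKf ?gt_eqF //.
  by lra.
have norm_cvg : norm21 (P (a j)) @[j --> \oo] --> norm21 Pstar.
  exact: (cvg_comp _ _ Pa_cvg (norm21_continuous Pstar)).
have ainv_cvg : (a j)^-1 @[j --> \oo] --> (0 : R).
  by apply/gtr0_cvgV0 => //; near=> j.
have gPa_cvg : g (P (a j)) @[j --> \oo] --> g Pstar.
  exact: (cvg_comp _ _ Pa_cvg g_cont).
have bound_cvg : k%:R + (a j)^-1 * (g (P (a j)) - g P0) @[j --> \oo] -->
    (k%:R + 0 * (g Pstar - g P0) : R).
  apply: cvgD; first exact: cvg_cst.
  by apply: cvgM => //; apply: cvgB => //; exact: cvg_cst.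
rewrite -[k%:R]addr0 -(mul0r (g Pstar - g P0)).
apply: (ler_cvg_to norm_cvg bound_cvg).
by near=> j.
Unshelve. all: by end_near. Qed.
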